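(* Let $\xi$ and $\nu$ be real random variables such that for every $a\in\mathbb{R}$, with $\phi(x)=(x-a)_+$, $$\mathbb{E}\,\phi(\xi)\le \mathbb{E}\,\phi(\nu),$$ and suppose that for some $\Gamma\ge 1$ and $\gamma>0$ and for all $t\ge 0$, $$\mathbb{P}(\nu\ge t)\le \Gamma e^{-\gamma t}.$$ Then for all $t\ge 0$, $$\mathbb{P}(\xi\ge t)\le \Gamma e^{1-\gamma t}.$$
   Context: For $x\in\mathbb{R}$, $(x)_+=\max(x,0)$. *)

(* Defs.v *)
From mathcomp Require Import all_boot all_order all_algebra.
From mathcomp Require Import all_classical all_reals all_analysis.

Set Implicit Arguments.
Unset Strict Implicit.
Unset Printing Implicit Defensive.

Import Order.TTheory GRing.Theory Num.Theory.
Local Open Scope ring_scope.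

Definition pos_part (R : realType) (x : R) : R := Num.max x 0.

(* Main.v *)
Require Import Defs.
From HB Require Import structures.
From mathcomp Require Import all_boot all_order all_algebra.
From mathcomp Require Import all_classical all_reals all_analysis measurable_realfun.

(** Test the hypothesis on the expected excess at one well chosen level [a].
    For [a < t], Markov's inequality and the comparison hypothesis give
      [(t - a) P(xi >= t) <= E (xi - a)_+ <= E (nu - a)_+],
    and the right-hand side is the integral of the upper tail of [nu] beyond
    [a] (layer-cake formula), which for [a >= 0] the exponential tail bound
    makes at most [Gamma e^(- gamma a) / gamma]. Hence
      [P(xi >= t) <= Gamma e^(- gamma a) / (gamma (t - a))].
    The choice [t - a = 1 / gamma], which minimizes the right-hand side, yields
    exactly [Gamma e^(1 - gamma t)], the factor [e] being the price of the step
    from [t] back to [a]. It requires [a >= 0], that is [1 <= gamma t]; for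
    smaller [t] the claimed bound is at least [Gamma >= 1], so it holds for any
    probability.

    The two halves are [tail_le_expected_excess] and
    [expected_excess_le_exp_tail]. *)

Set Implicit Arguments.
Unset Strict Implicit.
Unset Printing Implicit Defensive.

Import Order.TTheory GRing.Theory Num.Theory.
Local Open Scope classical_set_scope.
Local Open Scope ring_scope.

Lemma integral_expR_halfline (R : realType) (g : R) : 0 < g ->
  (\int[lebesgue_measure]_(s in `[0%R, +oo[) (expR (- (g * s)))%:E
   = (g^-1)%:E :> \bar R)%E.
Proof.
move=> g0; have gV0 : 0 <= g^-1 by rewrite invr_ge0 ltW.
have pdf0 (s : R) : (0 <= (exponential_pdf g s)%:E)%E.
  by rewrite lee_fin exponential_pdf_ge0 // ltW.
have mpdf : measurable_fun [set: R] (EFin \o exponential_pdf g).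
  by apply/measurable_EFinP; exact: measurable_exponential_pdf.
(* The integrand is [g^-1] times the density of the exponential law. *)
transitivity
  (\int[lebesgue_measure]_s ((g^-1)%:E * (exponential_pdf g s)%:E) : \bar R)%E.
  rewrite integral_mkcond; apply: eq_integral => s _.
  rewrite /exponential_pdf !patchE; case: ifP => _; last by rewrite mule0.
  by rewrite -EFinM mulrA mulVf ?gt_eqF // mul1r mulNr.
by rewrite ge0_integralZl_EFin // integral_exponential_pdf // mule1.
Qed.

Lemma pos_part_ge0 (R : realType) (x : R) : 0 <= pos_part x.
Proof. by rewrite /pos_part le_max lexx orbT. Qed.

Section expected_excess.
Context d (T : measurableType d) (R : realType) (P : probability T R).
Variable X : {RV P >-> R}.
Implicit Types a c g t : R.

Let excess a (w : T) : R := pos_part (X w - a).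

Let measurable_excess a : measurable_fun [set: T] (excess a).
Proof.
rewrite /excess /pos_part; apply: measurable_maxr; last exact: measurable_cst.
by apply: measurable_funB; [exact: measurable_funP | exact: measurable_cst].
Qed.

HB.instance Definition _ a := isMeasurableFun.Build _ _ _ _ (excess a)
  (measurable_excess a).

(** On the event [t <= X] the excess over a lower level [a] is at least
    [t - a]; this is Markov's inequality for the excess. *)
Lemma tail_le_expected_excess a t : a < t ->
  ((t - a)%:E * P [set w | (t <= X w)%R]
   <= 'E_P[(fun x => pos_part (x - a)) \o X])%E.
Proof.
move=> a_lt_t; have ta0 : 0 < t - a by rewrite subr_gt0.
have absE : idfun \o (fun x : R => `|x|) \o excess a = excess a.
  by apply/funext => w /=; rewrite ger0_norm // pos_part_ge0.
have := @markov _ _ _ P (excess a) idfun (t - a) ta0 (@measurable_id _ _ _)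
  (fun _ h => h) (fun _ _ _ _ h => h).
rewrite absE; apply: le_trans; rewrite lee_wpmul2l ?lee_fin ?(ltW ta0) //.
have mX : measurable_fun [set: T] X by exact: measurable_funP.
apply: le_measure; rewrite ?inE.
- by rewrite -[X in measurable X]setTI; exact: measurable_fun_le.
- rewrite -[X in measurable X]setTI.
  under eq_set => w do rewrite lee_fin ger0_norm ?pos_part_ge0 //.
  exact: measurable_fun_le.
- move=> w /= tX; rewrite lee_fin ger0_norm ?pos_part_ge0 //.
  by rewrite /excess /pos_part le_max lerB.
Qed.

(** By the layer-cake formula the expected excess over [a] is the integral of
    the tail of [X] beyond [a], so an exponential bound on that tail
    integrates to an exponential bound on the excess. *)
Lemma expected_excess_le_exp_tail c g a : 0 <= c -> 0 < g ->
  (forall t, a <= t -> (P [set w | (t <= X w)%R] <= (c * expR (- (g * t)))%:E)%E) ->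
  ('E_P[(fun x => pos_part (x - a))%R \o X] <= (c * expR (- (g * a)) / g)%:E)%E.
Proof.
move=> c0 g0 tailX; set K := c * expR (- (g * a)).
have K0 : 0 <= K by rewrite mulr_ge0 ?expR_ge0.
have mexp : measurable_fun (`[0, +oo[%classic : set R)
    (EFin \o (fun s => expR (- (g * s)))).
  apply/measurable_EFinP; apply: measurableT_comp => //.
  by apply: measurableT_comp => //; exact: measurable_funM.
have mX : measurable_fun [set: T] X by exact: measurable_funP.
rewrite (_ : _ \o X = excess a) // ge0_expectation_ccdf; last first.
  by move=> w; exact: pos_part_ge0.
rewrite EFinM -integral_expR_halfline // -ge0_integralZl_EFin //.
apply: ge0_le_integral => //.
- by apply: measurable_funTS; exact: ccdf_measurable.
- exact: measurable_funeM.
move=> s /=; rewrite in_itv /= andbT => s0.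
have := tailX (a + s); rewrite lerDl => /(_ s0).
rewrite mulrDr opprD expRD mulrA EFinM; apply: le_trans.
rewrite /ccdf /distribution /pushforward; apply: le_measure; rewrite ?inE.
- exact: measurable_funPTI.
- by rewrite -[X in measurable X]setTI; exact: measurable_fun_le.
move=> w /=; rewrite in_itv /= andbT /excess /pos_part lt_max => /orP[|].
  by rewrite ltrBrDl => /ltW.
by rewrite ltNge s0.
Qed.

End expected_excess.

Theorem lemma1 (R : realType) (d1 d2 : measure_display)
  (T1 : measurableType d1) (T2 : measurableType d2)
  (P1 : probability T1 R) (P2 : probability T2 R)
  (xi : {RV P1 >-> R}) (nu : {RV P2 >-> R})
  (Gamma gamma : R)
  (hphi : forall a : R,
    let phi := fun x : R => pos_part (x - a) in
    ('E_P1[phi \o xi] <= 'E_P2[phi \o nu])%E)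
  (hGamma : 1 <= Gamma) (hgamma : 0 < gamma)
  (hnu : forall t : R, 0 <= t ->
    (P2 [set w | (t <= nu w)%R] <= (Gamma * expR (- (gamma * t)))%:E)%E) :
  forall t : R, 0 <= t ->
    (P1 [set w | (t <= xi w)%R] <= (Gamma * expR (1 - gamma * t))%:E)%E.
Proof.
move=> t t0; have Gamma0 : 0 <= Gamma by exact: le_trans hGamma.
case: (lerP 1 (gamma * t)) => [gt1|gt1]; last first.
  apply: (le_trans (probability_le1 _ _)).
    rewrite -[X in measurable X]setTI; apply: measurable_fun_le => //.
  rewrite lee_fin -[leLHS]mulr1 ler_pM // ltW // expR_gt1.
  by rewrite subr_gt0.
pose a := t - gamma^-1.
have a0 : 0 <= a by rewrite subr_ge0 -[leLHS]mulr1 ler_pdivrMl.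
have a_lt_t : a < t by rewrite ltrBlDr ltrDl invr_gt0.
have := le_trans (tail_le_expected_excess xi a_lt_t) (le_trans (hphi a)
  (expected_excess_le_exp_tail Gamma0 hgamma
    (fun s a_le_s => hnu s (le_trans a0 a_le_s)))).
have -> : t - a = gamma^-1 by rewrite /a opprB addrC subrK.
have -> : - (gamma * a) = 1 - gamma * t.
  by rewrite /a mulrBr mulfV ?gt_eqF // opprB.
by rewrite [X in (_ <= X)%E]EFinM muleC lee_pmul2r // lte_fin invr_gt0.
Qed.
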